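(* Let $R$ be a Frobenius ring that is a finite-dimensional algebra over each of two fields $k_1$ and $k_2$ (so that $R$ is a Frobenius $k_1$-algebra and a Frobenius $k_2$-algebra). Let $\sigma_1$ be a Nakayama automorphism of $R$ as a Frobenius $k_1$-algebra and $\sigma_2$ a Nakayama automorphism of $R$ as a Frobenius $k_2$-algebra. Then $\sigma_1$ and $\sigma_2$ are equal up to composition with an inner automorphism: there is a unit $u$ of $R$ such that $\sigma_2(r) = u\,\sigma_1(r)\,u^{-1}$ for all $r \in R$. That is, the Nakayama automorphism of $R$, as an element of the group of outer (ring) automorphisms of $R$, is independent of the ground field.
   Context: Rings are associative with identity. A ring $R$ is an algebra over a field $k$ via a unital ring homomorphism $k \to Z(R)$ into the center of $R$; no relation between $k_1$ and $k_2$ is assumed. An artinian ring $R$ is a Frobenius ring if $R$ is isomorphic, as a left $R$-module, to the injective hull of the left $R$-module $R/\mathrm{rad}\,R$, where $\mathrm{rad}\,R$ is the Jacobson radical. For a finite-dimensional $k$-algebra $R$, the $k$-dual $\hat R = \mathrm{Hom}_k(R,k)$ is an $(R,R)$-bimodule via $(rf)(s) = f(sr)$ and $(fr)(s) = f(rs)$. $R$ is a Frobenius $k$-algebra if $R \simeq \hat R$ as left $R$-modules; equivalently, there is a $k$-linear functional $\lambda : R \to k$ whose kernel contains no nonzero left ideal. It is known that a finite-dimensional $k$-algebra is a Frobenius $k$-algebra if and only if it is a Frobenius ring, so this property does not depend on $k$. Given such a functional $\lambda$, there is a unique $k$-linear map $\sigma : R \to R$ with $\lambda(rs) = \lambda(s\,\sigma(r))$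 for all $r,s \in R$; it is a $k$-algebra automorphism of $R$, called the Nakayama automorphism of $R$ (as a $k$-algebra, determined by $\lambda$). Changing $\lambda$ changes $\sigma$ only by composition with an inner automorphism, and all such compositions $r\mapsto u\sigma(r)u^{-1}$ with $u$ a unit of $R$ occur. *)

(* Defs.v *)
From HB Require Import structures.
From mathcomp Require Import all_boot all_order all_algebra.

Set Implicit Arguments.
Unset Strict Implicit.
Unset Printing Implicit Defensive.

Import GRing.Theory.
Local Open Scope ring_scope.

(* Rings are [pzRingType]s, so the zero ring is allowed.  Submodules, ideals and
   kernels are [Prop]-valued predicates: MathComp's [submod_closed] only covers
   the decidable ones. *)

Definition submodule (R : pzRingType) (M : lmodType R) (N : M -> Prop) : Prop :=
  N 0 /\ forall (a : R) (x y : M), N x -> N y -> N (a *: x + y).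

Definition left_ideal (R : pzRingType) (I : R -> Prop) : Prop :=
  submodule (M := R^o) I.

Definition left_artinian (R : pzRingType) : Prop :=
  forall I : nat -> R -> Prop,
    (forall n, left_ideal (I n)) ->
    (forall n x, I n.+1 x -> I n x) ->
    exists n, forall m x, (n <= m)%N -> I n x -> I m x.

(* [R^c] is the opposite ring: its left ideals are the right ideals of [R]. *)
Definition artinian (R : pzRingType) : Prop :=
  left_artinian R /\ left_artinian R^c.

Definition maximal_left_ideal (R : pzRingType) (I : R -> Prop) : Prop :=
  [/\ left_ideal I, ~ I 1 &
      forall J : R -> Prop, left_ideal J -> (forall x, I x -> J x) -> ~ J 1 ->
        forall x, J x -> I x].

Definition jacobson_radical (R : pzRingType) (x : R) : Prop :=
  forall I : R -> Prop, maximal_left_ideal I -> I x.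

Definition injective_module (R : pzRingType) (E : lmodType R) : Prop :=
  forall (A B : lmodType R) (f : {linear A -> B}) (g : {linear A -> E}),
    injective f -> exists h : {linear B -> E}, forall a, h (f a) = g a.

Definition essential (R : pzRingType) (S E : lmodType R) (j : {linear S -> E}) :
    Prop :=
  forall N : E -> Prop, submodule N -> (exists2 x, N x & x <> 0) ->
    exists2 s, N (j s) & j s <> 0.

Definition injective_hull (R : pzRingType) (S E : lmodType R)
    (j : {linear S -> E}) : Prop :=
  [/\ injective j, essential j & injective_module E].

(* [S] with the projection [p] is the left module [R / rad R], given up to
   isomorphism as the image of a surjection from [R] with kernel [rad R]. *)
Definition frobenius_ring (R : pzRingType) : Prop :=
  artinian R /\
  exists (S E : lmodType R) (p : {linear R^o -> S}) (j : {linear S -> E})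
         (phi : {linear R^o -> E}),
    [/\ forall s, exists x, p x = s,
        forall x, p x = 0 <-> jacobson_radical x,
        injective_hull j &
        bijective phi].

(* The ring [R] seen as a [k]-module through a ring morphism [i : k -> R]; a type
   alias, so that one ring can carry several such structures. *)
Definition alg_via (k R : pzRingType) (i : {rmorphism k -> R}) : Type := R.

Section AlgVia.
Variables (k R : pzRingType) (i : {rmorphism k -> R}).

HB.instance Definition _ := GRing.PzRing.on (alg_via i).

Definition alg_via_scale (a : k) (x : alg_via i) : alg_via i := i a * (x : R).

Fact alg_via_scaleA a b x :
  alg_via_scale a (alg_via_scale b x) = alg_via_scale (a * b) x.
Proof. by rewrite /alg_via_scale rmorphM mulrA. Qed.

Fact alg_via_scale1 : left_id 1 alg_via_scale.
Proof. by move=> x; rewrite /alg_via_scale rmorph1 mul1r. Qed.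

Fact alg_via_scaleDr : right_distributive alg_via_scale +%R.
Proof. by move=> a x y; rewrite /alg_via_scale mulrDr. Qed.

Fact alg_via_scaleDl x : {morph alg_via_scale^~ x : a b / a + b}.
Proof. by move=> a b; rewrite /alg_via_scale rmorphD mulrDl. Qed.

HB.instance Definition _ := GRing.Zmodule_isLmodule.Build k (alg_via i)
  alg_via_scaleA alg_via_scale1 alg_via_scaleDr alg_via_scaleDl.

End AlgVia.

(* [i] makes [R] a finite-dimensional [k]-algebra. *)
Definition findim_algebra (k : fieldType) (R : pzRingType)
    (i : {rmorphism k -> R}) : Prop :=
  (forall (a : k) (x : R), GRing.comm (i a) x) /\
  exists n : nat, inhabited (Vector.axiom n (alg_via i)).

Definition frobenius_functional (k : fieldType) (R : pzRingType)
    (i : {rmorphism k -> R}) (lambda : {scalar alg_via i}) : Prop :=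
  forall I : R -> Prop, left_ideal I -> (forall x, I x -> lambda x = 0) ->
    forall x, I x -> x = 0.

Definition nakayama_automorphism (k : fieldType) (R : pzRingType)
    (i : {rmorphism k -> R}) (sigma : R -> R) : Prop :=
  linear (sigma : alg_via i -> alg_via i) /\
  exists2 lambda : {scalar alg_via i},
    frobenius_functional lambda &
    forall r s : R, lambda (r * s) = lambda (s * sigma r).

(* Main.v *)
(* Let [Z] be the center of [R] and [C] the largest [Z]-submodule in the kernel of a
   Frobenius functional [lambda1] over [k1].  The functionals over [k1] killing [C] are
   the [lambda1 (z * _)] with [z] in [Z], so [R / C] is an injective [Z]-module in which
   every homomorphism from a submodule is multiplication by an element of [Z]; distinct
   simple submodules are thus never isomorphic.  This property no longer mentions [k1],
   and it yields a functional [mu] over [k2] on [R / C] whose kernel contains no nonzero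
   [Z]-submodule: extend [mu] along a chain of submodules, modifying it when a new
   simple submodule appears in its kernel.  Since [r * s - s * sigma1 r] lies in [C],
   [mu] is a Frobenius functional over [k2] with the same Nakayama automorphism
   [sigma1], and two Frobenius functionals over [k2] differ by a unit. *)
Require Import Defs.
From HB Require Import structures.
From mathcomp Require Import all_boot all_order all_algebra.
From mathcomp Require Import boolp.

Set Implicit Arguments.
Unset Strict Implicit.
Unset Printing Implicit Defensive.

Import GRing.Theory VectorInternalTheory.
Local Open Scope ring_scope.

(** * Finite-dimensional linear algebra with [Prop]-valued subspaces *)

Definition finite_dim (k : fieldType) (V : lmodType k) : Prop :=
  exists n : nat, inhabited (Vector.axiom n V).

(** Finite dimension is only a proposition here; this gives access to the [vectType] theory of
    subspaces and dimensions. *)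
Lemma finite_dim_vectType (k : fieldType) (P : lmodType k -> Prop) :
  (forall V : vectType k, P V) -> forall V : lmodType k, finite_dim V -> P V.
Proof.
move=> PV [S c] [n [ax]].
pose W : vectType k := HB.pack S c (Lmodule_hasFinDim.Build k (GRing.Lmodule.Pack c) ax).
exact: (PV W).
Qed.

Lemma vectType_finite_dim (k : fieldType) (V : vectType k) : finite_dim V.
Proof.
exists (dim V); constructor; exists (@v2r k V); first exact: linearP.
by exists (@r2v k V); [exact: v2rK | exact: r2vK].
Qed.

Lemma finite_dim_pair (k : fieldType) (V W : lmodType k) :
  finite_dim V -> finite_dim W -> finite_dim (V * W)%type.
Proof.
move: V; apply: finite_dim_vectType => V; move: W; apply: finite_dim_vectType => W.
exact: (@vectType_finite_dim k (V * W)%type).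
Qed.

(** A subspace of maximal dimension inside [N] exhausts it: adjoining another vector of [N] would
    raise the dimension. *)
Lemma submodule_vspace (k : fieldType) (V : vectType k) (N : V -> Prop) :
  submodule N -> exists U : {vspace V}, forall x, x \in U <-> N x.
Proof.
move=> [N0 NL].
pose P n := `[< exists2 U : {vspace V}, \dim U = n & forall x, x \in U -> N x >].
have exP : exists n, P n.
  exists 0%N; apply/asboolP; exists 0%VS; first exact: dimv0.
  by move=> x; rewrite memv0 => /eqP->.
have ubP n : P n -> (n <= \dim {:V})%N.
  by move=> /asboolP[U <- _]; exact/dimvS/subvf.
case: (ex_maxnP exP ubP) => n /asboolP[U dU UN] maxU.
exists U => x; split=> [/UN//|Nx]; apply: contrapT => /negP xU.
have : P (\dim (U + <[x]>)).
  apply/asboolP; exists (U + <[x]>)%VS => // y /memv_addP[u uU [w]].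
  move=> /vlineP[a ->] ->; rewrite addrC; apply: NL => //; exact: UN.
move=> /maxU; rewrite -dU => dUx.
have /eqP UE : U == (U + <[x]>)%VS by rewrite eqEdim addvSl.
by case/negP: xU; rewrite UE memvE addvSr.
Qed.

Lemma separating_functional (k : fieldType) (V : lmodType k) (N : V -> Prop) p :
  finite_dim V -> submodule N -> ~ N p ->
  exists2 f : {scalar V}, (forall x, N x -> f x = 0) & f p <> 0.
Proof.
move=> fdV; move: V fdV N p; apply: finite_dim_vectType => V N p subN Np.
have [U UN] := submodule_vspace subN.
(* Coordinates of the component of [x] along a complement of [U]: zero on [U], nonzero at [p]. *)
pose g x : 'rV_(dim V) := v2r (x - projv U x).
have gL : linear g.
  move=> a x y; rewrite /g -linearP; congr v2r.
  by rewrite linearP opprD addrACA scalerBr.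
have : g p != 0.
  rewrite -(linear0 (@v2r k V)).
  rewrite (inj_eq (@v2r_inj k V)) subr_eq0.
  by apply/eqP => pE; apply/Np/UN; rewrite pE memv_proj.
move=> /rV0Pn[j gpj].
pose f x : k := g x 0 j.
have fL : scalar f by move=> a x y; rewrite /f gL !mxE.
pose F : {scalar V} := HB.pack f (GRing.isLinear.Build k V k *%R f fL).
exists F; last exact/eqP.
by move=> x /UN xU; rewrite /F /= /f /g projv_id// subrr linear0 mxE.
Qed.

(* [G] is the graph of a functional defined on a subspace of [V]; a functional on
   [V * k^o] that separates it from [(0, 1)] yields the extension. *)
Lemma extend_functional (k : fieldType) (V : lmodType k) (G : V * k^o -> Prop) :
  finite_dim V -> submodule G -> (forall a, G (0, a) -> a = 0) ->
  exists h : {scalar V}, forall x a, G (x, a) -> h x = a.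
Proof.
move=> fdV subG G0.
have [||F FG F01] := @separating_functional k (V * k^o)%type G (0, 1) _ subG.
- exact: finite_dim_pair fdV (@vectType_finite_dim k k^o).
- by move=> /G0/eqP; rewrite oner_eq0.
pose f x : k := - (F (x, 0) / F (0, 1)).
have fL : scalar f.
  move=> a x y; rewrite /f.
  have -> : (a *: x + y, 0) = a *: (x, 0) + (y, 0) :> V * k^o.
    by congr pair; rewrite /= ?scaler0 ?addr0.
  by rewrite linearP mulrDl opprD mulrN mulrA.
pose h : {scalar V} := HB.pack f (GRing.isLinear.Build k V k *%R f fL).
exists h => x a /FG; rewrite /h /= /f.
have -> : (x, a) = a *: (0, 1) + (x, 0) :> V * k^o.
  by congr pair; rewrite /= ?scaler0 ?add0r// addr0 /GRing.scale/= mulr1.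
rewrite linearP => /eqP; rewrite addrC addr_eq0 => /eqP->.
by rewrite mulNr opprK mulfK//; exact/eqP.
Qed.

(** A nondegenerate [B] embeds [V] in its dual, and the embedding is onto because the dimensions
    agree. *)
Lemma represent_functional (k : fieldType) (V : lmodType k) (B : V -> V -> k) :
  finite_dim V -> (forall x, scalar (B x)) -> (forall y, scalar (B^~ y)) ->
  (forall x, (forall y, B x y = 0) -> x = 0) ->
  forall g : {scalar V}, exists x, forall y, g y = B x y.
Proof.
move=> fdV; move: V fdV B; apply: finite_dim_vectType => V B Br Bl B0 g.
pose toHom (f : V -> k) (fL : scalar f) : 'Hom(V, k^o) :=
  linfun (HB.pack_for {linear V -> k^o} (f : V -> k^o)
    (GRing.isLinear.Build k V k^o *:%R (f : V -> k^o) fL)).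
have toHomE f (fL : scalar f) x : toHom f fL x = f x by rewrite lfunE.
pose b x := toHom (B x) (Br x).
have bL : linear b.
  by move=> a x y; apply/lfunP => z; rewrite add_lfunE scale_lfunE !toHomE Bl.
pose c : 'Hom(V, 'Hom(V, k^o)) :=
  linfun (HB.pack_for {linear V -> 'Hom(V, k^o)} b
    (GRing.isLinear.Build k V 'Hom(V, k^o) *:%R b bL)).
have cE x y : c x y = B x y by rewrite lfunE /= toHomE.
have kerc : lker c = 0%VS.
  apply/eqP; rewrite -subv0; apply/subvP => x; rewrite memv_ker memv0 => /eqP cx.
  by apply/eqP/B0 => y; rewrite -cE cx lfunE.
have limgc : limg c = fullv.
  apply/eqP; rewrite eqEdim subvf /= limg_dim_eq ?kerc ?capv0//.
  by rewrite !dimvf /dim /= muln1.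
have : toHom g (@linearP _ _ _ _ g) \in limg c by rewrite limgc memvf.
by move=> /memv_imgP[x _ gE]; exists x => y; rewrite -cE -gE toHomE.
Qed.

(** A bounded, strictly monotone measure on submodules, for inductions along chains and minimal
    choices. *)
Lemma dimension_function (k : fieldType) (V : lmodType k) :
  finite_dim V -> exists (d : (V -> Prop) -> nat) (n : nat),
    (forall N, submodule N -> (d N <= n)%N) /\
    forall M N, submodule M -> submodule N -> (forall x, M x -> N x) ->
      (d N <= d M)%N -> forall x, N x -> M x.
Proof.
move: V; apply: finite_dim_vectType => V.
have [|U UN] := @choice (V -> Prop) {vspace V}
  (fun N U => submodule N -> forall x, x \in U <-> N x).
  move=> N; have [/submodule_vspace[U UN]|nN] := pselect (submodule N).
    by exists U.
  (* Default value for predicates that are not submodules. *)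
  by exists 0%VS.
exists (fun N => \dim (U N)), (\dim {:V}); split=> [N _|M N sM sN MN dNM x Nx].
  exact/dimvS/subvf.
have /eqP UMN : U M == U N.
  rewrite eqEdim dNM andbT; apply/subvP => y /(UN _ sM)/MN; exact: (UN _ sN y).2.
by apply/(UN _ sM); rewrite UMN; exact/(UN _ sN).
Qed.

(** * Functionals as multiples of a Frobenius functional *)

Section FrobeniusFunctional.
Variables (k : fieldType) (R : pzRingType) (i : {rmorphism k -> R}).
Variable lambda : {scalar alg_via i}.
Hypotheses (fdR : findim_algebra i) (frob : frobenius_functional lambda).

Let mulrZ (a : k) (x y : R) : x * (i a * y) = i a * (x * y).
Proof. by rewrite mulrA -(fdR.1 a x) -mulrA. Qed.

Let lambdaL (a : k) (x y : R) : lambda (i a * x + y) = a * lambda x + lambda y.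
Proof. exact: (scalarP lambda). Qed.

(** The left ideal generated by [a - b] lies in the kernel of [lambda]. *)
Lemma functional_mulIr (a b : R) :
  (forall s : R, lambda (s * a) = lambda (s * b)) -> a = b.
Proof.
move=> ab; apply/eqP; rewrite -subr_eq0; apply/eqP.
apply: (@frob (fun y => exists r : R, y = r * (a - b))).
- split; first by exists 0; rewrite mul0r.
  by move=> c _ _ [r ->] [r' ->]; exists (c * r + r'); rewrite mulrDl -mulrA.
- by move=> _ [r ->]; rewrite mulrBr (linearB lambda) ab subrr.
- by exists 1; rewrite mul1r.
Qed.

Lemma functional_mulr (g : {scalar alg_via i}) :
  exists c : R, forall s : R, g s = lambda (s * c).
Proof.
apply: (@represent_functional k (alg_via i) (fun c s : R => lambda (s * c)) _ _ _ _ g).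
- exact: fdR.2.
- by move=> x a y y'; rewrite [X in lambda X]mulrDl -mulrA lambdaL.
- by move=> y a x x'; rewrite [X in lambda X]mulrDr mulrZ lambdaL.
- by move=> c c0; apply: functional_mulIr => s; rewrite c0 mulr0 (linear0 lambda).
Qed.

(** Passes from left to right ideals: a functional nonzero at [r] would be of the form
    [lambda (_ * c)], which vanishes at [r]. *)
Lemma functional_nondegenerate (r : R) : (forall s : R, lambda (r * s) = 0) -> r = 0.
Proof.
move=> r0; apply: contrapT => rN0.
have [|f _] := @separating_functional _ _ (fun x => x = 0) (r : alg_via i) fdR.2 _ rN0.
  by split=> // a _ _ -> ->; rewrite scaler0 addr0.
by have [c ->] := functional_mulr f; rewrite r0.
Qed.

Lemma functional_mull (g : {scalar alg_via i}) :
  exists c : R, forall s : R, g s = lambda (c * s).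
Proof.
apply: (@represent_functional k (alg_via i) (fun c s : R => lambda (c * s)) _ _ _ _ g).
- exact: fdR.2.
- by move=> x a y y'; rewrite [X in lambda X]mulrDr mulrZ lambdaL.
- by move=> y a x x'; rewrite [X in lambda X]mulrDl -mulrA lambdaL.
- exact: functional_nondegenerate.
Qed.

End FrobeniusFunctional.

(** * Submodules over the center *)

Definition central (R : pzRingType) (z : R) : Prop := forall x, GRing.comm z x.

Lemma central1 (R : pzRingType) : central (1 : R).
Proof. by move=> x; exact/commr_sym/commr1. Qed.

Lemma central0 (R : pzRingType) : central (0 : R).
Proof. by move=> x; exact/commr_sym/commr0. Qed.

Lemma centralD (R : pzRingType) (z w : R) : central z -> central w -> central (z + w).
Proof. by move=> cz cw x; apply/commr_sym/commrD; exact/commr_sym. Qed.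

Lemma centralM (R : pzRingType) (z w : R) : central z -> central w -> central (z * w).
Proof. by move=> cz cw x; apply/commr_sym/commrM; exact/commr_sym. Qed.

(** This notion mentions no ground field, yet yields a subspace for each algebra structure; it
    carries information from [k1] to [k2]. *)
Definition center_submodule (R : pzRingType) (N : R -> Prop) : Prop :=
  N 0 /\ forall z x y, central z -> N x -> N y -> N (z * x + y).

Section CenterSubmodule.
Variables (R : pzRingType) (N : R -> Prop).
Hypothesis subN : center_submodule N.

Lemma center_submoduleM z x : central z -> N x -> N (z * x).
Proof. by move=> cz Nx; rewrite -[_ * _]addr0; apply: subN.2 => //; exact: subN.1. Qed.

Lemma center_submoduleD x y : N x -> N y -> N (x + y).
Proof. by move=> Nx Ny; rewrite -[x]mul1r; apply: subN.2 => //; exact: central1. Qed.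

Lemma center_submoduleN x : N x -> N (- x).
Proof.
by rewrite -mulN1r; apply: center_submoduleM => y; exact/commr_sym/commrN1.
Qed.

Lemma center_submoduleB x y : N x -> N y -> N (x - y).
Proof. by move=> Nx Ny; exact/center_submoduleD/center_submoduleN. Qed.

Lemma center_submodule_alg (k : fieldType) (i : {rmorphism k -> R}) :
  findim_algebra i -> submodule (M := alg_via i) N.
Proof.
move=> fdR; split; first exact: subN.1.
by move=> a x y; apply: subN.2 => z; exact: fdR.1.
Qed.

End CenterSubmodule.

Lemma center_submodule_adjoin (R : pzRingType) (N : R -> Prop) (x : R) :
  center_submodule N ->
  center_submodule (fun y => exists2 z, central z & N (y - z * x)).
Proof.
move=> subN; split.
  by exists 0; [exact: central0 | rewrite mul0r subr0; exact: subN.1].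
move=> z y y' cz [w cw Nw] [w' cw' Nw']; exists (z * w + w').
  by apply: centralD => //; exact: centralM.
have -> : z * y + y' - (z * w + w') * x = z * (y - w * x) + (y' - w' * x).
  by rewrite mulrDl mulrBr mulrA opprD addrACA.
exact: subN.2.
Qed.

(** * The core of a functional: the largest center-submodule in its kernel *)

Definition center_core (R : pzRingType) (A : nmodType) (lambda : R -> A) (y : R) : Prop :=
  forall z, central z -> lambda (z * y) = 0.

Section Nakayama.
Variables (k : fieldType) (R : pzRingType) (i : {rmorphism k -> R}).
Variables (lambda : {scalar alg_via i}) (sigma : R -> R).
Hypotheses (fdR : findim_algebra i) (frob : frobenius_functional lambda).
Hypothesis nak : forall r s : R, lambda (r * s) = lambda (s * sigma r).

Local Notation C := (center_core (lambda : R -> k)).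

Lemma center_core_submodule : center_submodule C.
Proof.
split=> [z _|z x y cz Cx Cy w cw]; first by rewrite mulr0 (linear0 lambda).
rewrite mulrDr mulrA (linearD lambda) Cx ?Cy ?addr0//; exact: centralM.
Qed.

(** A central [z] can be moved past [r], so that [nak] applies to [r] and [z * s]. *)
Lemma center_core_twist (r s : R) : C (r * s - s * sigma r).
Proof.
move=> z cz; rewrite mulrBr (linearB lambda) mulrA (cz r) -mulrA nak mulrA.
exact: subrr.
Qed.

(** Writing [g] as [lambda (c * _)], the value of [lambda] at [(c * r - r * c) * s] is
    [g (r * s - s * sigma r)], which is zero. *)
Lemma functional_center (g : {scalar alg_via i}) :
  (forall y, C y -> g y = 0) ->
  exists2 c : R, central c & forall s : R, g s = lambda (c * s).
Proof.
move=> gC; have [c gE] := functional_mull fdR frob g.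
exists c => // r; apply/eqP; rewrite -subr_eq0; apply/eqP.
apply: (functional_nondegenerate fdR frob) => s.
rewrite mulrBl (linearB lambda) -!mulrA (nak r) -mulrA -!gE.
rewrite -(linearB g); apply: gC; exact: center_core_twist.
Qed.

(* The center-module [R / C] is injective: the functional [w * p |-> lambda (w * y)]
   extends to [R] and is thus of the form [lambda (z * _)]. *)
Lemma center_core_injective (p y : R) :
  (forall w, central w -> C (w * p) -> C (w * y)) ->
  exists2 z, central z & C (y - z * p).
Proof.
move=> Cpy; have [C0 CL] := center_core_submodule.
(* Working modulo [C] makes the extension kill [C]; [Cpy] makes the graph single-valued. *)
pose G (v : alg_via i * k^o) := exists2 w, central w &
  C ((v.1 : R) - w * p) /\ v.2 = lambda (w * y).
have [||h hE] := @extend_functional _ (alg_via i) G fdR.2.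
- split.
    exists 0; first exact: central0.
    by rewrite !mul0r subr0 (linear0 lambda).
  move=> a [u b] [u' b'] [w cw [Cw bE]] [w' cw' [Cw' b'E]].
  have ca : central (i a) by exact: fdR.1.
  exists (i a * w + w').
    by apply: centralD => //; exact: centralM.
  split; last by move: bE b'E => /= -> ->; rewrite mulrDl -mulrA (scalarP lambda).
  have -> : (a *: (u, b) + (u', b')).1 - (i a * w + w') * p
      = i a * ((u : R) - w * p) + ((u' : R) - w' * p).
    by rewrite mulrDl mulrBr mulrA opprD addrACA.
  exact: CL.
- move=> a [w cw [Cw /= ->]]; rewrite -[w * y]mul1r; apply: Cpy => //; last exact: central1.
  by have := center_submoduleN center_core_submodule Cw; rewrite sub0r opprK.
have [|z cz zE] := functional_center (g := h).
  move=> x Cx; apply: hE; exists 0; first exact: central0.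
  by rewrite /= !mul0r subr0 (linear0 lambda).
exists z => // w cw; rewrite mulrBr mulrA (cw z) -mulrA (linearB lambda) -zE.
rewrite (hE (w * p) (lambda (w * y))) ?subrr//.
by exists w => //=; rewrite subrr.
Qed.

End Nakayama.

(** * A functional over another field with core inside [C] *)

Section CoreFunctional.
Variables (k : fieldType) (R : pzRingType) (i : {rmorphism k -> R}).
Variable C : R -> Prop.
Hypotheses (fdR : findim_algebra i) (subC : center_submodule C).
(* [R / C] is injective with respect to its cyclic center-submodules. *)
Hypothesis injC : forall p y : R,
  (forall w, central w -> C (w * p) -> C (w * y)) ->
  exists2 z, central z & C (y - z * p).

Let good (N : R -> Prop) (mu : {scalar alg_via i}) :=
  (forall x, C x -> mu x = 0) /\ forall x, N x -> center_core mu x -> C x.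

(** By the last hypothesis, each element of [N'] outside [N] generates [N'] modulo [N]. If the core
    of [mu] contains a new [p], then [mu] is corrected by [tau], zero on [N] but not at [p]. A bad
    [q] for the sum would generate another copy of the same simple module in [R / C], which [injC]
    excludes. *)
Lemma extend_core_functional (N N' : R -> Prop) (mu : {scalar alg_via i}) :
  center_submodule N -> (forall x, C x -> N x) -> good N mu ->
  (forall p q, N' p -> N' q -> ~ N q -> exists2 z, central z & N (p - z * q)) ->
  exists mu', good N' mu'.
Proof.
move=> subN CN [muC muN] N'min.
have [goodN'|] := pselect (forall x, N' x -> center_core mu x -> C x).
  by exists mu.
move=> /existsNP[p /not_implyP[N'p /not_implyP[mup Cp]]].
have Np : ~ N p by move=> Np; exact/Cp/muN.
have [tau tauN taup] :=
  @separating_functional k (alg_via i) N p fdR.2 (center_submodule_alg subN fdR) Np.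
pose mu' : {scalar alg_via i} := mu \+ tau.
have mu'E x : mu' x = mu x + tau x by [].
have mu'N x : N x -> mu' x = mu x by move=> Nx; rewrite mu'E tauN// addr0.
exists mu'; split=> [x Cx|q N'q mu'q]; first by rewrite mu'N ?muC//; exact: CN.
apply: contrapT => Cq.
have Nq : ~ N q.
  move=> Nq; apply/Cq/muN => // z cz.
  by rewrite -mu'N ?mu'q//; exact: center_submoduleM.
have [z0 cz0 Ny] := N'min p q N'p N'q Nq; set y := p - z0 * q in Ny.
(* The map sending [w * p] to [w * y] is well defined modulo [C]: when [w * p] is in [C], the
   element [w * y] of [N] is in the core of [mu]. *)
have [w cw Cwp|z cz Czp] := injC (p := p) (y := y).
  apply: muN => [|z cz]; first exact: center_submoduleM.
  have Czwp : C (z * (w * p)) by exact: center_submoduleM.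
  rewrite -mu'N; last by do 2!apply: center_submoduleM => //.
  rewrite /y !mulrBr (linearB mu') mu'N ?muC ?sub0r//; last exact: CN.
  by rewrite !mulrA mu'q ?oppr0//; do 2?apply: centralM.
(* Modulo [C], [y] is [z * p], which thus lies both in [N] and in the core of [mu], hence in [C]. *)
have Cy : C y.
  rewrite -(subrK (z * p) y); apply: center_submoduleD => //; apply: muN.
    by rewrite -(subKr y (z * p)); apply: center_submoduleB => //; exact: CN.
  by move=> w cw; rewrite mulrA mup//; exact: centralM.
(* [mu'] agrees with [tau] at [p], but vanishes on both summands [y] and [z0 * q] of [p]. *)
apply: taup; have := mu'E p; rewrite -[mu p](congr1 mu (mul1r p)) mup ?add0r.
  move=> <-; rewrite -(subrK (z0 * q) p) (linearD mu') mu'q// addr0.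
  by rewrite mu'N ?muC//; exact: CN.
exact: central1.
Qed.

Lemma exists_core_functional : exists mu : {scalar alg_via i},
  (forall x, C x -> mu x = 0) /\ forall x, center_core mu x -> C x.
Proof.
have [d [n [d_le d_lt]]] := dimension_function fdR.2.
have sub_alg N (subN : center_submodule N) := center_submodule_alg subN fdR.
(* Induction on a strict bound [m] for the codimension of [N], starting from the zero functional on
   [C]. *)
suff ext m (N : R -> Prop) mu : center_submodule N -> (forall x, C x -> N x) ->
    good N mu -> (n - d N < m)%N -> exists mu', good (fun=> True) mu'.
  have [|mu [muC mu_core]] := @ext _ C \0 subC (fun=> id) _ (leqnn _).
    by split=> // x Cx.
  by exists mu; split=> // x; exact: mu_core.
elim: m N mu => // m IHm N mu subN CN goodN dN.
have [Nfull|/existsNP[x0 Nx0]] := pselect (forall x, N x).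
  by exists mu; split=> [|x _]; [exact: goodN.1 | exact: goodN.2].
pose adjoin x y := exists2 z, central z & N (y - z * x).
have subA x : center_submodule (adjoin x) := center_submodule_adjoin x subN.
have NA x y : N y -> adjoin x y.
  by exists 0; [exact: central0 | rewrite mul0r subr0].
(* Minimal dimension of [adjoin x] makes it simple over [N]: any [q] in it outside [N] adjoins the
   same submodule. *)
pose P j := `[< exists2 x, ~ N x & d (adjoin x) = j >].
have exP : exists j, P j by exists (d (adjoin x0)); apply/asboolP; exists x0.
case: (ex_minnP exP) => _ /asboolP[x Nx <-] dmin.
have [p q Ap Aq Nq|mu' goodA] := extend_core_functional (N' := adjoin x) subN CN goodN.
  apply: (d_lt (adjoin q) (adjoin x)) => //; [exact: sub_alg | exact: sub_alg | | ].
    move=> y [z cz Ny]; rewrite -(subrK (z * q) y).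
    apply: center_submoduleD => //; first exact: NA.
    exact: center_submoduleM.
  by apply: dmin; apply/asboolP; exists q.
apply: (IHm (adjoin x) mu') => // [y /CN|]; first exact: NA.
have dNA : (d N < d (adjoin x))%N.
  rewrite ltnNge; apply/negP => dA; apply: Nx.
  apply: (d_lt N (adjoin x)) => //; [exact: sub_alg | exact: sub_alg | exact: NA |].
  by exists 1; [exact: central1 | rewrite mul1r subrr; exact: subN.1].
rewrite ltnS in dN; apply: leq_trans dN; apply: ltn_sub2l => //.
exact: leq_trans dNA (d_le _ (sub_alg _ _)).
Qed.

End CoreFunctional.

(** * Comparison of the two Nakayama automorphisms *)

Theorem theorem4 (R : pzRingType) (k1 k2 : fieldType)
    (i1 : {rmorphism k1 -> R}) (i2 : {rmorphism k2 -> R})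
    (frobR : frobenius_ring R)
    (alg1 : findim_algebra i1) (alg2 : findim_algebra i2)
    (sigma1 sigma2 : R -> R)
    (nak1 : nakayama_automorphism i1 sigma1)
    (nak2 : nakayama_automorphism i2 sigma2) :
  exists u v : R, [/\ u * v = 1, v * u = 1 &
    forall r : R, sigma2 r = u * sigma1 r * v].
Proof.
have [_ [lambda1 frob1 twist1]] := nak1; have [_ [lambda2 frob2 twist2]] := nak2.
have [mu [muC mu_core]] := exists_core_functional alg2
  (center_core_submodule lambda1) (center_core_injective alg1 frob1 twist1).
have twist r s : mu (r * s) = mu (s * sigma1 r).
  apply/eqP; rewrite -subr_eq0 -(linearB mu); apply/eqP.
  exact/muC/center_core_twist.
(* A left ideal in the kernel of [mu] is stable under the center, hence lies in the core of [mu], so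
   in [C] and in the kernel of [lambda1]. *)
have frob : frobenius_functional mu.
  move=> I idI Imu; apply: (frob1 I idI) => x Ix.
  rewrite -[x]mul1r; apply: mu_core; last exact: central1.
  by move=> z _; apply: Imu; rewrite -[_ * _]addr0; apply: idI.2 => //; exact: idI.1.
have [v muE] := functional_mulr alg2 frob2 mu.
have [u lambdaE] := functional_mulr alg2 frob lambda2.
exists u, v; split=> [||r].
- by apply: (functional_mulIr frob2) => s; rewrite mulr1 mulrA -muE -lambdaE.
- by apply: (functional_mulIr frob) => s; rewrite mulr1 mulrA -lambdaE -muE.
(* Both sides equal [lambda2 (r * s)], which is [mu (r * s * u)], that is
   [mu (s * u * sigma1 r)]. *)
- apply: (functional_mulIr frob2) => s.
  by rewrite -twist2 lambdaE -mulrA twist muE !mulrA.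
Qed.
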